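(* Let $(G,H,\mathcal{L})$ be a cut-and-project scheme with $G=\mathbb{R}^d$ such that $\mathcal{L}$ and $\mathcal{L}^\circ$ are both countable. Let $D$ be a lattice in $\mathbb{R}^d$ with $D\cap\pi^G(\mathcal{L})=\{0\}$ and $D^\circ\cap\pi^{\widehat G}(\mathcal{L}^\circ)=\{0\}$, let $\mathbb{K}=\mathbb{R}^d/D$ with quotient map $\psi$, let $H'=H\times\mathbb{K}$, let $\phi:\pi^G(\mathcal{L})\to H'$, $\phi(x)=(x^\star,\psi(x))$, and let $\mathcal{L}'=\{(x,\phi(x)):x\in\pi^G(\mathcal{L})\}$. Then: (a) $(G,H',\mathcal{L}')$ is a cut-and-project scheme whose $\star$-map is $\phi$, and $\phi$ is injective; (b) for every $W\subseteq H$ we have $\Lambda_W=\Lambda'_{W'}$, where $W'=W\times\mathbb{K}$; (c) if $H$ is $\sigma$-compact (resp. metrisable), then so is $H'$.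
   Context: A cut-and-project scheme $(G,H,\mathcal{L})$ consists of locally compact abelian groups $G,H$ and a discrete cocompact subgroup $\mathcal{L}\subseteq G\times H$ such that $\pi^G|_{\mathcal{L}}$ is injective and $\pi^H(\mathcal{L})$ is dense in $H$. The $\star$-map on $\pi^G(\mathcal{L})$ is $x^\star=\pi^H((\pi^G|_{\mathcal{L}})^{-1}(x))$. $\Lambda_W=\pi^G(\mathcal{L}\cap(G\times W))$ and $\Lambda'_{W'}=\pi^G(\mathcal{L}'\cap(G\times W'))$. The dual group $\widehat G$ is identified with $\mathbb{R}^d$ via $x\mapsto(y\mapsto e^{2\pi i\langle x,y\rangle})$; $\mathcal{L}^\circ\subseteq\widehat G\times\widehat H$ is the annihilator of $\mathcal L$ and $\pi^{\widehat G}$ the projection to $\widehat G$. For a lattice $D$, $D^\circ=\{x\in\mathbb{R}^d:\langle y,x\rangle\in\mathbb{Z}\ \forall y\in D\}$. *)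

(* Defs.v *)
From HB Require Import structures.
From mathcomp Require Import all_boot all_order all_algebra.
From mathcomp Require Import all_classical all_reals all_analysis.
From mathcomp Require Import generic_quotient.
Set Implicit Arguments. Unset Strict Implicit. Unset Printing Implicit Defensive.
Import Order.TTheory GRing.Theory Num.Theory.
Import numFieldNormedType.Exports.
Local Open Scope classical_set_scope.
Local Open Scope ring_scope.

(* Types carrying both an abelian group structure and a topology
   (no compatibility assumed at the type level; see LCA_group). *)
HB.saturate prod.
HB.saturate matrix.
Notation zmodTopType := PreTopologicalZmodule.type.

Section LCA.
Context {T : zmodTopType}.

Definition LCA_group : Prop :=
  [/\ continuous (fun x : T * T => x.1 + x.2),
      continuous (-%R : T -> T),
      hausdorff_space T &
      locally_compact [set: T]].

Definition is_subgroup (A : set T) : Prop :=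
  A 0 /\ forall a b, A a -> A b -> A (a - b).

Definition discrete_subset (A : set T) : Prop :=
  forall a, A a -> exists2 U, nbhs a U & A `&` U `<=` [set a].

Definition cocompact (A : set T) : Prop :=
  exists2 C : set T, compact C &
    forall t, exists c, exists2 a, C c /\ A a & t = c + a.

Definition sigma_compact : Prop :=
  exists2 K : nat -> set T, (forall n, compact (K n)) & \bigcup_n K n = setT.

End LCA.
Arguments LCA_group : clear implicits.
Arguments sigma_compact : clear implicits.

Definition metrisable (R : realType) (T : topologicalType) : Prop :=
  exists dist : T -> T -> R,
    [/\ forall x y, dist x y = 0 <-> x = y,
        forall x y, dist x y = dist y x,
        forall x y z, dist x z <= dist x y + dist y z &
        forall U : set T, open U <->
          (forall x, U x -> exists2 r : R, 0 < r & [set y | dist x y < r] `<=` U)].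

Section CPS.
Context {G H : zmodTopType}.

Definition cut_and_project (L : set (G * H)) : Prop :=
  [/\ LCA_group G, LCA_group H,
      is_subgroup L /\ discrete_subset L /\ cocompact L,
      (forall z w, L z -> L w -> z.1 = w.1 -> z = w) &
      dense (snd @` L)].

(* The star map x |-> pi^H((pi^G|_L)^{-1}(x)) on pi^G(L) (arbitrary outside). *)
Definition star (L : set (G * H)) (x : G) : H := xget 0 [set h | L (x, h)].

Definition model_set (L : set (G * H)) (W : set H) : set G :=
  fst @` (L `&` (setT `*` W)).

End CPS.

Section Rd.
Context {R : realType} {d : nat}.

Definition dotv (x y : 'rV[R]_d) : R := \sum_(i < d) x 0 i * y 0 i.

Definition is_lattice (D : set 'rV[R]_d) : Prop :=
  exists2 B : 'M[R]_d, B \in unitmx &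
    D = [set z *m B | z in [set z : 'rV[R]_d | forall i, z 0 i \is a Num.int]].

Definition dual_lattice (D : set 'rV[R]_d) : set 'rV[R]_d :=
  [set x | forall y, D y -> dotv y x \is a Num.int].

End Rd.

(* The circle group U(1) is represented inside R x R (= C) *)
Section Circle.
Context {R : realType}.
Definition cmul (z w : R * R) : R * R := (z.1 * w.1 - z.2 * w.2, z.1 * w.2 + z.2 * w.1).
Definition expi (t : R) : R * R := (cos (2 * trigo.pi * t), sin (2 * trigo.pi * t)).

Definition character (H : zmodTopType) (chi : H -> R * R) : Prop :=
  [/\ continuous chi,
      forall h, (chi h).1 ^+ 2 + (chi h).2 ^+ 2 = 1 &
      forall a b, chi (a + b) = cmul (chi a) (chi b)].

(* The annihilator L° in hat G x hat H, where hat G = R^d via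
   xi |-> (y |-> e^{2 pi i <xi,y>}). *)
Definition annihilator {d : nat} {H : zmodTopType} (L : set ('rV[R]_d * H))
  : set ('rV[R]_d * (H -> R * R)) :=
  [set p | character p.2 /\
           forall z, L z -> cmul (expi (dotv p.1 z.1)) (p.2 z.2) = (1, 0)].
End Circle.

Section Quot.
Context {V : zmodType}.
Variable D : set V.

(* subgroup generated by D (equal to D when D is a lattice) *)
Definition gen_subgroup (v : V) : Prop :=
  forall S : set V, D `<=` S -> S 0 ->
    (forall a b, S a -> S b -> S (a - b)) -> S v.

Lemma gen_subgroup0 : gen_subgroup 0.
Proof. by move=> Y _ S0 _. Qed.

Lemma gen_subgroupB a b : gen_subgroup a -> gen_subgroup b -> gen_subgroup (a - b).
Proof. move=> ha hb Y DS S0 SB; by apply: (SB); [exact: (ha Y DS S0 SB)|exact: (hb Y DS S0 SB)]. Qed.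

Lemma gen_subgroupN a : gen_subgroup a -> gen_subgroup (- a).
Proof. by move=> ha; rewrite -sub0r; apply: gen_subgroupB => //; exact: gen_subgroup0. Qed.

Definition modrel (x y : V) : bool := `[< gen_subgroup (x - y) >].

Lemma modrel_refl : reflexive modrel.
Proof. by move=> x; apply/asboolP; rewrite subrr; exact: gen_subgroup0. Qed.

Lemma modrel_sym : symmetric modrel.
Proof.
move=> x y; apply/idP/idP => /asboolP h; apply/asboolP; rewrite -opprB; exact: gen_subgroupN.
Qed.

Lemma modrel_trans : transitive modrel.
Proof.
move=> y x z /asboolP hxy /asboolP hyz; apply/asboolP.
have -> : x - z = (x - y) - (z - y) by rewrite opprB addrA subrK.
apply: gen_subgroupB => //; rewrite -opprB; exact: gen_subgroupN.
Qed.

Canonical modrel_equiv := EquivRel modrel modrel_refl modrel_sym modrel_trans.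

Local Open Scope quotient_scope.

Definition quot0 := {eq_quot modrel_equiv}.

Lemma modrelD x x' y y' : modrel x x' -> modrel y y' -> modrel (x + y) (x' + y').
Proof.
move=> /asboolP h1 /asboolP h2; apply/asboolP.
have -> : x + y - (x' + y') = (x - x') - (y' - y) by rewrite opprB opprD addrACA addrC.
by apply: gen_subgroupB => //; rewrite -opprB; exact: gen_subgroupN.
Qed.

Lemma modrelN x x' : modrel x x' -> modrel (- x) (- x').
Proof.
move=> /asboolP h; apply/asboolP; rewrite -opprD; exact: gen_subgroupN.
Qed.

Definition qzero : quot0 := \pi_quot0 0.
Definition qopp (a : quot0) : quot0 := \pi_quot0 (- repr a).
Definition qadd (a b : quot0) : quot0 := \pi_quot0 (repr a + repr b).

Lemma repr_pi x : modrel (repr (\pi_quot0 x)) x.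
Proof. by apply/eqmodP; rewrite reprK. Qed.

Lemma qaddE x y : qadd (\pi_quot0 x) (\pi_quot0 y) = \pi_quot0 (x + y).
Proof. by apply/eqmodP; apply: modrelD; apply: repr_pi. Qed.

Lemma qoppE x : qopp (\pi_quot0 x) = \pi_quot0 (- x).
Proof. by apply/eqmodP; apply: modrelN; apply: repr_pi. Qed.

Lemma quot_surj (a : quot0) : exists x, a = \pi_quot0 x.
Proof. by exists (repr a); rewrite reprK. Qed.

Lemma qaddA : associative qadd.
Proof.
move=> a b c; have [x ->] := quot_surj a; have [y ->] := quot_surj b.
by have [z ->] := quot_surj c; rewrite !qaddE addrA.
Qed.

Lemma qaddC : commutative qadd.
Proof.
move=> a b; have [x ->] := quot_surj a; have [y ->] := quot_surj b.
by rewrite !qaddE addrC.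
Qed.

Lemma qadd0 : left_id qzero qadd.
Proof. by move=> a; have [x ->] := quot_surj a; rewrite /qzero qaddE add0r. Qed.

Lemma qaddN : left_inverse qzero qopp qadd.
Proof. by move=> a; have [x ->] := quot_surj a; rewrite qoppE qaddE addNr. Qed.

End Quot.

Notation torus D := (quotient_topology (quot0 D)).

Section TorusInst.
Context {R : realType} {d : nat} (D : set 'rV[R]_d).
HB.instance Definition _ :=
  GRing.isZmodule.Build (torus D) (@qaddA _ D) (@qaddC _ D) (@qadd0 _ D) (@qaddN _ D).
End TorusInst.

Local Open Scope quotient_scope.
Definition quot_map {R : realType} {d : nat} (D : set 'rV[R]_d) : 'rV[R]_d -> torus D :=
  \pi_(torus D).

(* Main.v *)
Require Import Defs.
From HB Require Import structures.
From mathcomp Require Import all_boot all_order all_algebra.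
From mathcomp Require Import all_classical all_reals all_analysis.
From mathcomp Require Import generic_quotient.
Set Implicit Arguments. Unset Strict Implicit. Unset Printing Implicit Defensive.
Import Order.TTheory GRing.Theory Num.Theory.
Import numFieldNormedType.Exports.
Local Open Scope classical_set_scope.
Local Open Scope ring_scope.
Local Open Scope quotient_scope.

(* No duality theory for locally compact groups is needed: only the density of
   the new star image uses the hypothesis on the dual lattice, and the relevant
   character can be produced by hand.  Let [A] be the closure of
   [{(x*, psi x) : x in pi^G(L)}] in [H x K].  Since [K] is compact, [A] projects
   onto [H].  Let [P] be the closed subgroup of those [x] in [R^d] with
   [(0, psi x)] in [A].  If [P = R^d] then [A = H x K].  Otherwise some [y <> 0]
   satisfies [<y, P> <= Z]; as [D <= P], [y] lies in the dual lattice of [D], and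
   [chi h = e(<y, k>)] for [(h, k)] in [A] is a well-defined character of [H].
   It agrees with [e(<y, x>)] at [x*], so [(-y, chi)] annihilates [L], against
   the hypothesis. *)

(** * Closed subgroups of R^n *)

Section Subgroups.
Context {T : zmodTopType}.
Implicit Types P : set T.

Lemma subgroup0 P : is_subgroup P -> P 0. Proof. by case. Qed.

Lemma subgroupB P x y : is_subgroup P -> P x -> P y -> P (x - y).
Proof. by case=> _; apply. Qed.

Lemma subgroupN P x : is_subgroup P -> P x -> P (- x).
Proof. by move=> gP Px; rewrite -sub0r; apply: subgroupB => //; exact: subgroup0. Qed.

Lemma subgroupD P x y : is_subgroup P -> P x -> P y -> P (x + y).
Proof.
by move=> gP Px Py; rewrite -[y]opprK; apply: subgroupB => //; exact: subgroupN.
Qed.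

Lemma subgroupMn P x n : is_subgroup P -> P x -> P (x *+ n).
Proof.
move=> gP Px; elim: n => [|n IH]; first exact: subgroup0.
by rewrite mulrS; exact: subgroupD.
Qed.

Lemma subgroupMz P x (m : int) : is_subgroup P -> P x -> P (x *~ m).
Proof.
move=> gP Px; case: m => n; first exact: subgroupMn.
by rewrite NegzE mulrNz; apply: subgroupN => //; exact: subgroupMn.
Qed.

Lemma subgroup_sum P (I : finType) (F : I -> T) :
  is_subgroup P -> (forall i, P (F i)) -> P (\sum_i F i).
Proof.
move=> gP PF; elim/big_ind: _ => //; first exact: subgroup0.
by move=> x y; exact: subgroupD.
Qed.

End Subgroups.

(** * Continuity and norm estimates for matrix maps over R *)

Section ContinuityInRn.
Context {R : realType}.

Lemma continuous_mx {T : topologicalType} m n (f : T -> 'M[R]_(m, n)) :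
  (forall i j, continuous (fun x => f x i j)) -> continuous f.
Proof.
move=> cf x A [Q Qn QA].
have : \forall y \near x, forall i j, Q i j (f y i j).
  apply: filter_forall => i; apply: filter_forall => j.
  exact: (cf i j x _ (Qn i j)).
by apply: filterS => y Hy; apply: QA.
Qed.

Lemma mulmxr_continuous m n p (C : 'M[R]_(n, p)) :
  continuous (fun x : 'M[R]_(m, n) => x *m C).
Proof.
apply: continuous_mx => i j.
have -> : (fun x : 'M[R]_(m, n) => (x *m C) i j) = (fun x => \sum_k x i k * C k j).
  by apply/funext => x; rewrite mxE.
apply: continuous_big => [|k _ x].
  by move=> x; apply: add_continuous.
exact: (cvgM (@coord_continuous R m n i k x) (cvg_cst (C k j))).
Qed.

Lemma mx_norm_lt m n (x : 'M[R]_(m, n)) e :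
  0 < e -> (forall i j, `|x i j| < e) -> `|x| < e.
Proof.
move=> e0 H; rewrite [ltLHS](_ : _ = mx_norm x)// mx_normrE.
by apply/bigmax_ltP; split => // -[i j] _.
Qed.

Lemma dotvE n (x y : 'rV[R]_n) : dotv x y = (x *m y^T) 0 0.
Proof. by rewrite mxE; apply: eq_bigr => i _; rewrite mxE. Qed.

Lemma dotvC n (x y : 'rV[R]_n) : dotv x y = dotv y x.
Proof. by apply: eq_bigr => i _; rewrite mulrC. Qed.

End ContinuityInRn.

(** * Integral functionals on proper closed subgroups of R^n *)

Section ClosedSubgroups.
Context {R : realType}.

(* A limit direction [v] of arbitrarily short elements [p]: integer multiples of
   [p] approximate every point of the line through [v]. *)
Lemma subgroup_line n (P : set 'rV[R]_n) : is_subgroup P -> closed P ->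
  (forall e : R, 0 < e -> exists2 p, P p & 0 < `|p| < e) ->
  exists2 v, v != 0 & forall t : R, P (t *: v).
Proof.
move=> gP cP small.
have smallk (k : nat) : exists p, P p /\ 0 < `|p| < k.+1%:R^-1.
  by have [|p] := small k.+1%:R^-1; [rewrite invr_gt0|exists p].
have [p Hp] := choice smallk.
pose u k := `|p k|^-1 *: p k.
have u1 k : `|u k| = 1.
  have [_ /andP[pk0 _]] := Hp k.
  by rewrite normrZ normrV ?unitfE ?gt_eqF// normr_id mulVf// gt_eqF.
have cS : compact [set x : 'rV[R]_n | `|x| = 1].
  apply: bounded_closed_compact.
    by exists 1; split => // M M1 x /= ->; exact: ltW.
  have := (continuous_closedP _).1 (@norm_continuous R 'rV[R]_n) _ (@closed_eq R 1).
  exact.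
have [v [v1 clv]] : [set x : 'rV[R]_n | `|x| = 1] `&` cluster (u @ \oo) !=set0.
  by apply: cS; exists 0%N => // k _; exact: u1.
exists v; first by rewrite -normr_gt0 v1 ltr01.
move=> t; apply: cP => B /nbhs_ballP[e /= e0 sB].
have [N HN] : exists N : nat, N.+1%:R^-1 < e / 2.
  have e20 : 0 < e / 2 by rewrite divr_gt0.
  have [N _ HN] := near_infty_natSinv_lt (PosNum e20).
  by exists N; apply: HN => /=.
(* The direction error will be multiplied by [m * |p k|], and [|t| + 1] bounds this factor because
   [|p k| <= 1]. *)
have d0 : 0 < e / 2 / (`|t| + 1) by rewrite !divr_gt0// ltr_wpDl.
have [w []] := clv [set u k | k in [set k | (N <= k)%N]] (ball v (e / 2 / (`|t| + 1)))
  ltac:(by exists N => // k /= Nk; exists k) (nbhsx_ballx _ _ d0).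
move=> [k /= Nk <-]; rewrite -ball_normE /= => vu.
have [Pk /andP[pk0 pk]] := Hp k.
have pk_le1 : `|p k| <= 1.
  by rewrite (le_trans (ltW pk))// invf_le1// ler1n.
have {}pk : `|p k| < e / 2.
  apply: lt_trans pk _; apply: le_lt_trans HN.
  by rewrite lef_pV2 ?posrE// ler_nat ltnS.
pose m := Num.floor (t / `|p k|).
have /andP[m1 m2] := floor_itv (t / `|p k|).
exists (p k *~ m); split; first exact: subgroupMz.
apply: sB; rewrite -ball_normE /=.
(* The first summand is the rounding error along [v], at most [|p k| < e / 2]; the second comes from
   replacing [v] by the direction [u k]. *)
have -> : t *: v - p k *~ m = (t - m%:~R * `|p k|) *: v + (m%:~R * `|p k|) *: (v - u k).
  rewrite /u scalerBr scalerA -mulrA mulfV ?gt_eqF// mulr1 scalerBl addrA subrK.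
  by rewrite scaler_int.
have H0 : 0 <= t - m%:~R * `|p k| by rewrite subr_ge0 -ler_pdivlMr.
have H1 : t - m%:~R * `|p k| <= `|p k|.
  rewrite lerBlDr -[X in X + _]mul1r -mulrDl -ler_pdivrMr//.
  by rewrite ltW// (lt_le_trans m2)// intrD addrC.
apply: le_lt_trans (ler_normD _ _) _; rewrite !normrZ v1 mulr1 [e]splitr ltrD//.
  by rewrite ger0_norm//; exact: le_lt_trans H1 pk.
move: vu; rewrite ltr_pdivlMr ?ltr_wpDl//; apply: le_lt_trans.
rewrite [leLHS]mulrC ler_wpM2l// -normrM -[m%:~R * _](subKr t).
apply: (le_trans (ler_normB _ _)); rewrite lerD2l.
by rewrite ger0_norm//; exact: le_trans H1 pk_le1.
Qed.

(** Pigeonhole: the [K.+1 ^ n + 1] multiples [k * c] reduced modulo 1 fall into [K.+1 ^ n] cubes of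
    side [1 / K.+1]. Two of them share a cube, and [q] is the difference of their indices. *)
Lemma dirichlet_approximation n K (c : 'I_n -> R) :
  exists2 q : nat, (0 < q <= K.+1 ^ n)%N &
    exists z : 'I_n -> int, forall i, `|q%:R * c i - (z i)%:~R| < K.+1%:R^-1.
Proof.
pose fr (x : R) := x - (Num.floor x)%:~R.
have fr0 x : 0 <= fr x by have /andP[] := floor_itv x; rewrite subr_ge0.
have fr1 x : fr x < 1 by have /andP[] := floor_itv x; rewrite intrD ltrBlDl.
pose box (k : 'I_(K.+1 ^ n).+1) : {ffun 'I_n -> 'I_K.+1} :=
  [ffun i => inord (Num.truncn (K.+1%:R * fr (k%:R * c i)))].
have /injectivePn[k [l kl bkl]] : ~~ injectiveb box.
  apply/negP => /injectiveP /leq_card.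
  by rewrite card_ffun !card_ord ltnn.
wlog ltkl : k l kl bkl / (k < l)%N.
  move=> W; have [lt|lt|/val_inj E] := ltngtP k l.
  - exact: (W k l).
  - by apply: (W l k); rewrite // eq_sym.
  - by rewrite E eqxx in kl.
exists (l - k)%N; first by rewrite subn_gt0 ltkl (leq_trans (leq_subr _ _))// -ltnS.
exists (fun i => Num.floor (l%:R * c i) - Num.floor (k%:R * c i)) => i.
(* Since [fr < 1], the truncation is at most [K], so [inord] never falls back on its default
   value. *)
have boxE (j : 'I_(K.+1 ^ n).+1) :
    (box j i)%:R <= K.+1%:R * fr (j%:R * c i) < (box j i)%:R + 1.
  have ge0 : 0 <= K.+1%:R * fr (j%:R * c i) by rewrite mulr_ge0.
  have /andP[t1 t2] := truncn_itv ge0.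
  rewrite ffunE inordK ?t1 ?natr1//.
  by rewrite -(ltr_nat R) (le_lt_trans t1)// gtr_pMr.
have := boxE k; have := boxE l; rewrite bkl => /andP[l1 l2] /andP[k1 k2].
rewrite natrB 1?ltnW// intrB.
have -> : (l%:R - k%:R) * c i - ((Num.floor (l%:R * c i))%:~R - (Num.floor (k%:R * c i))%:~R)
    = fr (l%:R * c i) - fr (k%:R * c i).
  by rewrite /fr mulrBl !opprD !opprK !addrA; congr (_ + _); rewrite addrAC.
rewrite -[ltRHS]mul1r ltr_pdivlMr// -[X in _ * X](@ger0_norm R)// -normrM mulrC mulrBr.
rewrite ltr_norml; apply/andP; split; rewrite ?ltrBrDr ?ltrBlDr.
  by rewrite addrC ltrBlDr (lt_le_trans k2)// lerD2r.
by rewrite (lt_le_trans l2)// addrC lerD2l.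
Qed.

Lemma intr_row_subgroup n m (P : set 'rV[R]_n) (C : 'M[R]_(m, n)) (z : 'I_m -> int) :
  is_subgroup P -> (forall i, P (row i C)) -> P ((\row_i (z i)%:~R) *m C).
Proof.
move=> gP PC; rewrite mulmx_sum_row; apply: subgroup_sum => // i.
by rewrite mxE scaler_int; exact: subgroupMz.
Qed.

(** Take finitely many elements of [P] of maximal rank: an element outside their span could be
    adjoined and would raise the rank. *)
Lemma max_rank_rows n (P : set 'rV[R]_n) :
  exists m (B : 'M[R]_(m, n)), (forall i, P (row i B)) /\ (forall p, P p -> (p <= B)%MS).
Proof.
pose Q k := `[< exists m (B : 'M[R]_(m, n)), (forall i, P (row i B)) /\ \rank B = k >].
have exQ : exists k, Q k.
  by exists 0%N; apply/asboolP; exists 0%N, 0; split; [case|rewrite mxrank0].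
have bQ k : Q k -> (k <= n)%N.
  by move=> /asboolP[m [B [_ <-]]]; exact: rank_leq_col.
case: (ex_maxnP exQ bQ) => k /asboolP[m [B [PB rB]]] maxk.
exists m, B; split=> // p Pp.
have sB : (B <= col_mx p B)%MS by rewrite -addsmxE addsmxSr.
have : (\rank (col_mx p B) <= k)%N.
  apply: maxk; apply/asboolP; exists (1 + m)%N, (col_mx p B); split => // i.
  case: (split_ordP i) => j ->.
    by rewrite rowKu [j]ord1 (_ : row 0 p = p)//; apply/rowP => a; rewrite mxE.
  by rewrite rowKd.
rewrite -rB => le_rank.
have le : (col_mx p B <= B)%MS.
  by rewrite -(geq_leqif (mxrank_leqif_sup sB)).
by move: le; rewrite col_mx_sub => /andP[].
Qed.

(* If the elements of [P] do not span, a vector orthogonal to [P] will do.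
   Otherwise [P] contains a basis [C], and by simultaneous approximation every
   [p] in [P] has a multiple [q p] with bounded [q] that is close to the lattice
   of [C], hence in it by discreteness; so [M!] clears all denominators. *)
Lemma discrete_subgroup_annihilator n (P : set 'rV[R]_n.+1) (e : R) :
  is_subgroup P -> 0 < e -> (forall p, P p -> `|p| < e -> p = 0) ->
  exists2 y, y != 0 & forall p, P p -> dotv y p \is a Num.int.
Proof.
move=> gP e0 discP; have [m [B [PB sB]]] := max_rank_rows P.
have [fB|nfB] := boolP (row_full B); last first.
  have k0 : kermx B^T != 0 by rewrite kermx_eq0 /row_free mxrank_tr.
  exists (nz_row (kermx B^T)); first by rewrite nz_row_eq0.
  move=> p /sB /submxP[u ->]; rewrite dotvE trmx_mul mulmxA.
  have /sub_kermxP -> := nz_row_sub (kermx B^T).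
  by rewrite mul0mx mxE; exact: rpred0.
pose C := rowsub (fullrankfun fB) B; have uC : C \in unitmx := fullrowsub_unit fB.
have PC i : P (row i C) by rewrite row_rowsub.
(* Continuity of multiplication by [C] at 0 converts the separation bound [e] in [P] into a bound on
   coordinates in the basis [C]. *)
have [K HK] : exists K : nat, forall x : 'rV[R]_n.+1, `|x| < K.+1%:R^-1 -> `|x *m C| < e.
  have := @mulmxr_continuous R 1 _ _ C 0 (ball 0 e).
  rewrite /= mul0mx => /(_ (nbhsx_ballx _ _ e0)) /nbhs_ballP[r /= r0 Hr].
  have [K _ HK] := near_infty_natSinv_lt (PosNum r0).
  exists K => x xK; have := Hr x; rewrite -!ball_normE /= !sub0r !normrN; apply.
  by apply: (lt_trans xK); apply: HK => /=.
pose M := (K.+1 ^ n.+1)%N.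
(* Up to the factor [M!] this is the first vector of the basis dual to [C]: its product with [p] is
   [M!] times the first coordinate of [p]. *)
exists (M`!%:R *: row 0 (invmx C)^T).
  rewrite scaler_eq0 negb_or pnatr_eq0 -lt0n fact_gt0 /=.
  apply/eqP => r0.
  have /matrixP/(_ 0 0) : row 0 (invmx C)^T *m C^T = row 0 1%:M.
    by rewrite -row_mul -trmx_mul mulmxV// trmx1.
  by rewrite r0 mul0mx !mxE => /eqP; rewrite eq_sym oner_eq0.
move=> p Pp.
have [q /andP[q0 qM] [z Hz]] := dirichlet_approximation K (fun i => (p *m invmx C) 0 i).
(* The difference of [q p] and the lattice point with coordinates [z] lies in [P] and has norm below
   [e], so it vanishes. *)
have zE : q%:R *: (p *m invmx C) = \row_i (z i)%:~R.
  apply/eqP; rewrite -subr_eq0; apply/eqP.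
  apply: (can_inj (mulmxK uC)); rewrite mul0mx; apply: discP.
    rewrite mulmxBl -scalemxAl mulmxKV// scaler_nat; apply: subgroupB => //.
      exact: subgroupMn.
    exact: intr_row_subgroup.
  apply: HK; apply: mx_norm_lt; first by rewrite invr_gt0.
  by move=> i j; rewrite [i]ord1 !mxE; have := Hz j; rewrite !mxE.
have [k Mk] : exists k, M`! = (k * q)%N.
  by apply/dvdnP/dvdn_fact; rewrite q0.
have -> : dotv (M`!%:R *: row 0 (invmx C)^T) p = M`!%:R * (p *m invmx C) 0 0.
  rewrite dotvE -scalemxAl mxE -dotvE dotvC dotvE; congr (_ * _).
  by rewrite !mxE; apply: eq_bigr => i _; rewrite !mxE.
have := congr1 (fun x : 'rV_n.+1 => x 0 0) zE; rewrite Mk natrM -mulrA => E.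
have -> : q%:R * (p *m invmx C) 0 0 = (z 0)%:~R by move: E; rewrite !mxE.
by rewrite rpredM// ?rpred_nat ?intr_int.
Qed.

(* A non-discrete [P] contains a line [R v]; project along [v] onto a coordinate
   hyperplane ([F], with section [E]) and use induction. *)
Lemma closed_subgroup_annihilator n (P : set 'rV[R]_n) x0 :
  is_subgroup P -> closed P -> ~ P x0 ->
  exists2 y, y != 0 & forall p, P p -> dotv y p \is a Num.int.
Proof.
elim: n => [|n IH] in P x0 *; first by move=> gP _; rewrite (thinmx0 x0); case: gP.
move=> gP cP nPx0.
have [[e [e0 discP]]|/forallNP small] :=
    pselect (exists e : R, 0 < e /\ forall p, P p -> `|p| < e -> p = 0).
  exact: discrete_subgroup_annihilator gP e0 discP.
have [|v v0 Pv] := @subgroup_line _ P gP cP.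
  move=> e e0; apply: contrapT => ne; apply: (small e); split => // p Pp pe.
  by apply: contra_notP ne => /eqP p0; exists p => //; rewrite normr_gt0 p0.
have [i vi0] : exists i, v 0 i != 0.
  apply: contra_notP (elimN eqP v0) => /forallNP vE; apply/rowP => i.
  by rewrite mxE; apply: contrapT => vi; apply: (vE i); exact/eqP.
(* [x *m G] is [x - (x_i / v_i) v], whose coordinate [i] is 0. [E] inserts a zero at position [i],
   and [F] applies [G] and then deletes that position. *)
pose G : 'M[R]_n.+1 := 1%:M - (v 0 i)^-1 *: (delta_mx i 0 *m v).
pose E : 'M[R]_(n, n.+1) := row' i 1%:M.
pose F : 'M[R]_(n.+1, n) := col' i G.
have GE a b : G a b = (a == b)%:R - (v 0 i)^-1 * ((a == i)%:R * v 0 b).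
  by rewrite !mxE big_ord1 !mxE eqxx andbT.
have EF : E *m F = 1%:M.
  apply/matrixP => a b; rewrite mxE (bigD1 (lift i a))//= big1 => [|k kj].
    rewrite !mxE eqxx mul1r addr0 big_ord1 !mxE eqxx andbT.
    rewrite [lift i a == i]eq_sym (negbTE (neq_lift i a)) mul0r mulr0 subr0.
    by rewrite (inj_eq lift_inj).
  by rewrite !mxE eq_sym (negbTE kj) mul0r.
have FE : F *m E = G.
  apply/matrixP => a b; rewrite mxE; case: (unliftP i b) => [b'|] ->.
    rewrite (bigD1 b')//= big1 => [|k kb]; first by rewrite !mxE eqxx mulr1 addr0.
    by rewrite !mxE (inj_eq lift_inj) (negbTE kb) mulr0.
  rewrite big1 => [|k _]; last first.
    by rewrite !mxE [lift i k == i]eq_sym (negbTE (neq_lift i k)) mulr0.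
  by rewrite GE mulrCA mulVf// mulr1 subrr.
(* [x] and [x *m G] differ by a multiple of [v], and all such multiples lie in [P]. *)
have PG x : P (x *m G) <-> P x.
  have -> : x *m G = x - (x 0 i / v 0 i) *: v.
    have -> : (x 0 i / v 0 i) *: v = (v 0 i)^-1 *: (x *m (delta_mx i 0 *m v)).
      by rewrite mulmxA -colE; apply/rowP => a; rewrite !mxE big_ord1 !mxE mulrCA mulrA.
    by rewrite mulmxBr mulmx1 -scalemxAr.
  split=> [Px|Px]; last exact: subgroupB.
  by rewrite -[x](subrK ((x 0 i / v 0 i) *: v)); exact: subgroupD.
have [|||y y0 Hy] := IH (fun q => P (q *m E)) (x0 *m F).
- split=> [|a b Pa Pb] /=; first by rewrite mul0mx; exact: subgroup0.
  by rewrite mulmxBl; exact: subgroupB.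
- exact: ((continuous_closedP _).1 (@mulmxr_continuous R 1 _ _ E) P cP).
- by rewrite -mulmxA FE PG.
exists (y *m F^T).
  apply: contra_neq y0 => yF0.
  by rewrite -[y]mulmx1 -trmx1 -EF trmx_mul mulmxA yF0 mul0mx.
move=> p Pp; have := Hy (p *m F); rewrite -mulmxA FE PG => /(_ Pp).
by rewrite !dotvE trmx_mul mulmxA.
Qed.

End ClosedSubgroups.

(** * Products, compactness and metrisability *)

Section Topology.

Lemma injective_hausdorff {T U : topologicalType} (f : T -> U) :
  continuous f -> injective f -> hausdorff_space U -> hausdorff_space T.
Proof.
move=> cf injf hU p q cl; apply/injf/hU => A B Ap Bq.
have [z [Az Bz]] := cl _ _ (cf p A Ap) (cf q B Bq).
by exists (f z).
Qed.

Lemma hausdorff_prod {T U : topologicalType} :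
  hausdorff_space T -> hausdorff_space U -> hausdorff_space (T * U)%type.
Proof.
move=> hT hU [p1 p2] [q1 q2] cl; congr pair.
- apply: hT => A B Ap Bq.
  have [z [Az Bz]] := cl (fst @^-1` A) (fst @^-1` B) (cvg_fst Ap) (cvg_fst Bq).
  by exists z.1.
- apply: hU => A B Ap Bq.
  have [z [Az Bz]] := cl (snd @^-1` A) (snd @^-1` B) (cvg_snd Ap) (cvg_snd Bq).
  by exists z.2.
Qed.

Lemma locally_compact_prod {T U : topologicalType} :
  locally_compact [set: T] -> locally_compact [set: U] ->
  locally_compact [set: (T * U)%type].
Proof.
move=> lT lU [x y] _.
have [A Ax [cA clA]] := lT x I; have [B By [cB clB]] := lU y I.
exists (A `*` B); last first.
  split; first exact: compact_setX.
  have -> : A `*` B = (fst @^-1` A) `&` (snd @^-1` B) by [].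
  by apply: closedI; apply: preimage_closed => // z _; [exact: cvg_fst|exact: cvg_snd].
move: Ax By; rewrite !within_interior ?interiorT// => Ax By.
by exists (A, B).
Qed.

Lemma compact_locally_compact {T : topologicalType} :
  compact [set: T] -> locally_compact [set: T].
Proof. by move=> cT x _; exists setT => //; exact: filterT. Qed.

Lemma sigma_compact_prod (T U : zmodTopType) :
  sigma_compact T -> compact [set: U] -> sigma_compact (T * U)%type.
Proof.
move=> [K cK KT] cU; exists (fun n => K n `*` setT) => [n|].
  exact: compact_setX.
apply/seteqP; split => // -[x y] _.
have [n _ Kx] : (\bigcup_n K n) x by rewrite KT.
by exists n.
Qed.

(** Over a limit point [x] of the projection, the parts of [A] above neighbourhoods of [x] generate
    a proper filter on [U]. Compactness gives it a cluster point [u], and closedness puts [(x, u)]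
    in [A]. *)
Lemma compact_projection_closed {T U : topologicalType} (A : set (T * U)) :
  compact [set: U] -> closed A -> closed (fst @` A).
Proof.
move=> cU cA x clx.
pose F := filter_from (nbhs x) (fun V => [set u | exists2 t, V t & A (t, u)]).
have FF : ProperFilter F.
  apply: filter_from_proper; last first.
    move=> V Vx; have [y [[[t u] /= Atu tE] Vy]] := clx V Vx.
    by exists u; exists t => //; rewrite tE.
  apply: filter_from_filter; first by exists setT; exact: filterT.
  move=> V W Vx Wx; exists (V `&` W); first exact: filterI.
  by move=> u [t [Vt Wt] Atu]; split; exists t.
have [u [_ clu]] := cU F FF (filterT : F setT).
exists (x, u) => //; apply: cA => B [[V W] [/= Vx Wu] VW].
have FV : F [set u | exists2 t, V t & A (t, u)] by exists V.
have [w [[t Vt Atw] Ww]] := clu _ _ FV Wu.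
by exists (t, w); split=> //; apply: VW.
Qed.

End Topology.

(** * Metrics on compact spaces and on products *)

Section Metrisable.
Context {R : realType}.

(** The norm distance is pulled back along [f]. Compactness makes [f] send closed sets to closed
    sets, so every open set of [T] is open for this distance; continuity gives the converse. *)
Lemma metrisable_compact {T : topologicalType} {V : normedModType R} (f : T -> V) :
  compact [set: T] -> continuous f -> injective f -> metrisable R T.
Proof.
move=> cT cf injf; exists (fun x y => `|f x - f y|); split.
- move=> x y; split=> [/normr0_eq0 /subr0_eq /injf//|->]; by rewrite subrr normr0.
- by move=> x y; exact: distrC.
- by move=> x y z; exact: ler_distD.
move=> U; split=> [oU x Ux|HU].
  have clfU : closed (f @` ~` U).
    apply: compact_closed; first exact: norm_hausdorff.
    apply: continuous_compact; first exact: continuous_subspaceT.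
    by apply: subclosed_compact cT _ => //; exact: open_closedC.
  have : nbhs (f x) (~` (f @` ~` U)).
    apply: open_nbhs_nbhs; split; first exact: closed_openC.
    by move=> [y nUy /injf yx]; apply: nUy; rewrite yx.
  move=> /nbhs_ballP[r /= r0 Hr]; exists r => // y /= xy.
  apply: contrapT => nUy; have := Hr (f y); rewrite -ball_normE /= => /(_ xy).
  by case; exists y.
rewrite openE => x Ux; have [r r0 Hr] := HU x Ux.
apply: filterS Hr _.
have nb : \forall y \near x, ball (f x) r (f y) := cf x _ (nbhsx_ballx _ _ r0).
by apply: filterS nb => y; rewrite -ball_normE.
Qed.

Lemma metrisable_prod {T U : topologicalType} :
  metrisable R T -> metrisable R U -> metrisable R (T * U)%type.
Proof.
(* Nonnegativity follows from the triangle inequality along [x, y, x] together with symmetry. *)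
have pos (X : Type) (d : X -> X -> R) : (forall x y, d x y = 0 <-> x = y) ->
    (forall x y, d x y = d y x) -> (forall x y z, d x z <= d x y + d y z) ->
    forall x y, 0 <= d x y.
  move=> d0 dC dT x y; have := dT x y x; rewrite (d0 x x).2// (dC y x).
  by rewrite -mulr2n pmulrn_lge0.
have ballo (X : topologicalType) (d : X -> X -> R) : (forall x y, d x y = 0 <-> x = y) ->
    (forall x y z, d x z <= d x y + d y z) ->
    (forall U : set X, open U <->
      (forall x, U x -> exists2 r : R, 0 < r & [set y | d x y < r] `<=` U)) ->
    forall x r, 0 < r -> nbhs x [set y | d x y < r].
  move=> d0 dT dO x r r0; apply: open_nbhs_nbhs; split; last first.
    by rewrite /= (d0 x x).2.
  apply/dO => y /= xy; exists (r - d x y); first by rewrite subr_gt0.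
  by move=> z /= yz; apply: le_lt_trans (dT x y z) _; rewrite addrC -ltrBrDr.
move=> [d1 [d10 d1C d1T d1O]] [d2 [d20 d2C d2T d2O]].
have p1 := pos _ _ d10 d1C d1T; have p2 := pos _ _ d20 d2C d2T.
exists (fun x y => d1 x.1 y.1 + d2 x.2 y.2); split.
- move=> [x1 x2] [y1 y2] /=; split=> [/eqP|[-> ->]].
    by rewrite paddr_eq0// => /andP[/eqP/d10 -> /eqP/d20 ->].
  by rewrite (d10 _ _).2// (d20 _ _).2// addr0.
- by move=> x y; rewrite d1C d2C.
- by move=> x y z; rewrite addrACA lerD.
move=> W; split=> [oW [x1 x2] Wx|HW].
  have [[A B] [/= Ax Bx] AB] : nbhs (x1, x2) W by exact: open_nbhs_nbhs.
  have [r r0 Hr] := (d1O A°).1 (open_interior _) x1 Ax.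
  have [s s0 Hs] := (d2O B°).1 (open_interior _) x2 Bx.
  exists (Num.min r s); first by rewrite lt_min r0.
  move=> [y1 y2] /=; rewrite lt_min => /andP[yr ys]; apply: AB; split => /=.
    by apply: interior_subset; apply: Hr; apply: le_lt_trans yr; rewrite lerDl.
  by apply: interior_subset; apply: Hs; apply: le_lt_trans ys; rewrite lerDr.
rewrite openE => -[x1 x2] Wx; have [r r0 Hr] := HW _ Wx.
have r20 : 0 < r / 2 by rewrite divr_gt0.
exists ([set y | d1 x1 y < r / 2], [set y | d2 x2 y < r / 2]).
  by split; exact: ballo.
by move=> [y1 y2] [/= h1 h2]; apply: Hr => /=; rewrite [r]splitr ltrD.
Qed.

End Metrisable.

(** * The exponential map from R to the circle *)

Section Expi.
Context {R : realType}.
Implicit Types s t : R.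

Lemma expiD s t : expi (s + t) = cmul (expi s) (expi t).
Proof.
by rewrite /expi /cmul /= mulrDr cosD sinD; congr pair; rewrite addrC.
Qed.

Lemma expi_norm t : (expi t).1 ^+ 2 + (expi t).2 ^+ 2 = 1.
Proof. exact: cos2Dsin2. Qed.

Lemma expi_int t : t \is a Num.int -> expi t = (1, 0).
Proof.
move=> /intrP[m ->].
have nat n : expi (n%:R : R) = (1, 0).
  rewrite /expi (_ : 2 * trigo.pi * n%:R = 0 + (trigo.pi *+ 2) *+ n); last first.
    by rewrite add0r mulr_natr mulr_natl.
  by rewrite (periodicn (@cosD2pi R)) (periodicn (@sinD2pi R)) cos0 sin0.
case: m => n; first exact: nat.
have [c s] := nat n.+1.
by rewrite NegzE intrN /expi mulrN cosN sinN c s oppr0.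
Qed.

(** Pass to the fractional part [f]. If [f] were nonzero, then [sin (pi f) > 0], and
    [cos (2 pi f) = 1 - 2 sin (pi f) ^ 2] would be below 1. *)
Lemma expi_eq1 t : expi t = (1, 0) -> t \is a Num.int.
Proof.
move=> t1; pose f := t - (Num.floor t)%:~R.
have /andP[f0 f1] : 0 <= f < 1.
  by have /andP[] := floor_itv t; rewrite /f subr_ge0 intrD ltrBlDl => -> ->.
suff f00 : f = 0 by rewrite (subr0_eq f00) intr_int.
have : expi f = (1, 0).
  have -> : f = t + (- (Num.floor t))%:~R by rewrite intrN.
  by rewrite expiD t1 (@expi_int (_)%:~R) ?intr_int// /cmul /= !mulr1 !mulr0 subr0 addr0.
case=> cf _; apply/eqP; apply: contra_eqT cf => fn0.
rewrite (_ : 2 * trigo.pi * f = (trigo.pi * f) *+ 2); last by rewrite -mulrA mulr_natl.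
rewrite cos_mulr2n cos2sin2 mulrnBl -addrA [- _ - _]addrC addrA [1 *+ 2]mulr2n addrK.
have : 0 < sin (trigo.pi * f).
  apply: sin_gt0_pi; rewrite mulr_gt0 ?pi_gt0 ?lt0r ?fn0//=.
  by rewrite gtr_pMr// pi_gt0.
by move=> sp; rewrite lt_eqF// gtrBl pmulrn_lgt0// exprn_gt0.
Qed.

Lemma expi_eq s t : expi s = expi t -> s - t \is a Num.int.
Proof.
move=> [c s']; apply: expi_eq1; rewrite /expi mulrBr cosB sinB c s'.
by rewrite -!expr2 cos2Dsin2 mulrC subrr.
Qed.

Lemma expi_continuous : continuous (expi : R -> R * R).
Proof.
have cm : continuous (fun t : R => 2 * trigo.pi * t) by exact: mulrl_continuous.
have cc : continuous (fun t : R => cos (2 * trigo.pi * t)).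
  by move=> t; exact: (continuous_comp (cm t) (@continuous_cos R _)).
have cs : continuous (fun t : R => sin (2 * trigo.pi * t)).
  by move=> t; exact: (continuous_comp (cm t) (@continuous_sin R _)).
by move=> t; exact: cvg_pair (cc t) (cs t).
Qed.

End Expi.

(** * The torus R^d / D *)

Section Lattice.
Context {R : realType} {d : nat}.
Implicit Types D : set 'rV[R]_d.

Lemma lattice_subgroup D : is_lattice D -> is_subgroup D.
Proof.
move=> [B _ ->]; split; first by exists 0; rewrite ?mul0mx// => i; rewrite mxE rpred0.
move=> _ _ [x xZ <-] [y yZ <-]; exists (x - y); rewrite ?mulmxBl// => i.
by rewrite !mxE rpredB.
Qed.

End Lattice.

Section Torus.
Context {R : realType} {d : nat}.
Variable D : set 'rV[R]_d.
Hypothesis gD : is_subgroup D.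

(** Reduces the quotient relation, stated through the generated subgroup, to membership of the
    difference in [D]. *)
Lemma gen_subgroup_id x : gen_subgroup D x <-> D x.
Proof.
split=> [gx|Dx]; last by move=> S DS _ _; exact: DS.
by apply: (gx D) => // [|a b]; [exact: subgroup0|exact: subgroupB].
Qed.

Lemma quot_map_eq x y : quot_map D x = quot_map D y <-> D (x - y).
Proof.
split=> [/eqmodP /asboolP /gen_subgroup_id //|Dxy].
by apply/eqmodP/asboolP/gen_subgroup_id.
Qed.

Lemma quot_mapK (k : torus D) : quot_map D (repr k) = k.
Proof. exact: reprK. Qed.

Lemma quot_mapD x y : quot_map D (x + y) = quot_map D x + quot_map D y.
Proof. exact/esym/qaddE. Qed.

Lemma quot_mapN x : quot_map D (- x) = - quot_map D x.
Proof. exact/esym/qoppE. Qed.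

Lemma quot_mapB x y : quot_map D (x - y) = quot_map D x - quot_map D y.
Proof. by rewrite quot_mapD quot_mapN. Qed.

Lemma quot_map0 : quot_map D 0 = 0.
Proof. by []. Qed.

Lemma quot_map_continuous : continuous (quot_map D).
Proof. exact: pi_continuous. Qed.

(** The quotient map is open, because the preimage of the image of an open set is the union of its
    translates by [D]. *)
Lemma quot_map_nbhs x (U : set 'rV[R]_d) :
  nbhs x U -> nbhs (quot_map D x) (quot_map D @` U).
Proof.
move=> xU; pose V := U°; have oV : open V := open_interior U.
have VU : quot_map D @` V `<=` quot_map D @` U.
  by apply: image_subset; exact: interior_subset.
apply: (filterS VU); apply: open_nbhs_nbhs; split; last by exists x.
have -> : open (quot_map D @` V) = open (quot_map D @^-1` (quot_map D @` V)) by [].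
rewrite openE => y [v Vv /quot_map_eq Dvy].
have nV : nbhs (y + (v - y)) V by rewrite addrC subrK; exact: open_nbhs_nbhs.
have ct : continuous (fun z : 'rV[R]_d => z + (v - y)).
  by move=> z; exact: (cvgD cvg_id (cvg_cst _)).
have nyV : \forall z \near y, V (z + (v - y)) := ct y V nV.
apply: filterS nyV => z Vz; exists (z + (v - y)) => //.
by apply/quot_map_eq; rewrite addrC addKr.
Qed.

Lemma torus_add_continuous : continuous (fun z : torus D * torus D => z.1 + z.2).
Proof.
move=> [a b] A /=; rewrite -[a]quot_mapK -[b]quot_mapK -quot_mapD.
move=> /(@quot_map_continuous _).
have : continuous (fun z : 'rV[R]_d * 'rV[R]_d => z.1 + z.2) by exact: add_continuous.
move=> /(_ (repr a, repr b)) ct /ct [[U V] [/= Ua Vb] UV].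
exists (quot_map D @` U, quot_map D @` V); first by split; exact: quot_map_nbhs.
move=> [_ _] [/= [u Uu <-] [v Vv <-]]; rewrite /= -quot_mapD.
exact: (UV (u, v)).
Qed.

Lemma torus_opp_continuous : continuous (-%R : torus D -> torus D).
Proof.
apply/quotient_continuous => x.
have -> : -%R \o \pi_(torus D) = quot_map D \o -%R.
  by apply/funext => y /=; exact/esym/quot_mapN.
have on : continuous (-%R : 'rV[R]_d -> 'rV[R]_d) by exact: opp_continuous.
exact: (continuous_comp (on x) (@quot_map_continuous _)).
Qed.

Lemma torus_map_continuous {Z : topologicalType} (g : 'rV[R]_d -> Z) :
  continuous g -> (forall a b, D (a - b) -> g a = g b) ->
  continuous (g \o repr : torus D -> Z).
Proof.
move=> cg gD'; apply: repr_comp_continuous => // a b /eqP /quot_map_eq Dab.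
by apply/eqP/gD'.
Qed.

Lemma torus_repr x : D (repr (quot_map D x) - x).
Proof. by apply/quot_map_eq; exact: reprK. Qed.

End Torus.

(** * Compactness, separation and metrisability of the torus of a lattice *)

Section LatticeTorus.
Context {R : realType} {d : nat}.
Variable D : set 'rV[R]_d.
Hypothesis latD : is_lattice D.
Let gD := lattice_subgroup latD.

(** Subtracting integer parts of the coordinates in the basis [B] shows that the compact unit cube
    already maps onto the torus. *)
Lemma torus_compact : compact [set: torus D].
Proof.
have [B uB DE] := latD.
have inD (z : 'rV[R]_d) : (forall i, z 0 i \is a Num.int) -> D (z *m B).
  by rewrite DE => zZ; exists z.
pose Q := [set x : 'rV[R]_d | forall i, `[(0 : R), 1]%classic (x ord0 i)].
have cQ : compact Q.
  by apply: (@rV_compact R d (fun=> `[(0 : R), 1]%classic)) => _; exact: segment_compact.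
have -> : [set: torus D] = (fun x => quot_map D (x *m B)) @` Q.
  apply/seteqP; split => // k _; pose c := repr k *m invmx B.
  exists (\row_i (c 0 i - (Num.floor (c 0 i))%:~R)).
    move=> i; rewrite /= mxE in_itv /=; have /andP[] := floor_itv (c 0 i).
    by rewrite subr_ge0 intrD lerBlDl => -> /ltW ->.
  rewrite -[RHS]quot_mapK; apply/quot_map_eq => //.
  have -> : (\row_i (c 0 i - (Num.floor (c 0 i))%:~R)) *m B - repr k
      = (\row_i - (Num.floor (c 0 i))%:~R) *m B.
    rewrite -[repr k](mulmxKV uB) -mulmxBl; congr (_ *m _); apply/rowP => i.
    by rewrite !mxE addrAC subrr sub0r.
  by apply: inD => i; rewrite mxE rpredN intr_int.
apply: continuous_compact => //; apply: continuous_subspaceT => x.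
exact: (continuous_comp (@mulmxr_continuous R 1 _ _ B x) (@quot_map_continuous _ _ D _)).
Qed.

(** Column [i] is the point of the circle given by the [i]-th coordinate in the lattice basis.
    Mapping the torus injectively into a normed space yields both the Hausdorff property and a
    metric. *)
Lemma torus_embedding : exists2 f : torus D -> 'M[R]_(2, d), continuous f & injective f.
Proof.
have [B uB DE] := latD.
pose g (x : 'rV[R]_d) : 'M[R]_(2, d) := \matrix_(a, i)
  if a == 0 then (expi ((x *m invmx B) 0 i)).1 else (expi ((x *m invmx B) 0 i)).2.
have gE x y : g x = g y <-> D (x - y).
  split=> [/matrixP gxy|].
    rewrite DE; exists ((x - y) *m invmx B); last by rewrite mulmxKV.
    move=> i; rewrite mulmxBl mxE [X in _ + X]mxE; apply: expi_eq.
    by have := gxy 0 i; have := gxy 1 i; rewrite !mxE /= => e1 e0; congr pair.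
  rewrite DE => -[z zZ /(canRL (mulmxK uB))]; rewrite mulmxBl => zE.
  apply/matrixP => a i; rewrite [LHS]mxE [RHS]mxE.
  suff -> : expi ((x *m invmx B) 0 i) = expi ((y *m invmx B) 0 i) by [].
  have -> : (x *m invmx B) 0 i = (y *m invmx B) 0 i + z 0 i.
    by rewrite zE !mxE addrCA subrr addr0.
  by rewrite expiD [expi (z 0 i)]expi_int// /cmul /= !mulr1 !mulr0 subr0 add0r.
exists (g \o repr).
  apply: torus_map_continuous => // [|a b /gE //].
  apply: continuous_mx => a i.
  have ce : continuous (fun x : 'rV[R]_d => expi ((x *m invmx B) 0 i)).
    move=> x.
    apply: (@continuous_comp _ _ _ (fun x : 'rV[R]_d => (x *m invmx B) 0 i) expi);
      last exact: expi_continuous.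
    apply: (@continuous_comp _ _ _ (fun x : 'rV[R]_d => x *m invmx B) (fun M => M 0 i)).
      exact: mulmxr_continuous.
    exact: coord_continuous.
  have -> : (fun x => g x a i) =
      (if a == 0 then fst else snd) \o (fun x : 'rV[R]_d => expi ((x *m invmx B) 0 i)).
    by apply/funext => x /=; rewrite mxE; case: ifP.
  move=> x; apply: continuous_comp; first exact: ce.
  by case: ifP => _; [exact: cvg_fst|exact: cvg_snd].
move=> k l /= /gE Dkl; rewrite -[k]quot_mapK -[l]quot_mapK.
exact/quot_map_eq.
Qed.

Lemma torus_hausdorff : hausdorff_space (torus D).
Proof.
have [f cf injf] := torus_embedding.
exact: injective_hausdorff cf injf (@norm_hausdorff _ _).
Qed.

Lemma torus_metrisable : metrisable R (torus D).
Proof.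
have [f cf injf] := torus_embedding.
exact: metrisable_compact torus_compact cf injf.
Qed.

Lemma torus_LCA : LCA_group (torus D).
Proof.
split; [exact: torus_add_continuous|exact: torus_opp_continuous|exact: torus_hausdorff|].
exact/compact_locally_compact/torus_compact.
Qed.

End LatticeTorus.

(** * The extended cut-and-project scheme *)

Section TopologicalGroups.

Lemma LCA_prod (A B : zmodTopType) :
  LCA_group A -> LCA_group B -> LCA_group (A * B)%type.
Proof.
move=> [addA oppA hA lA] [addB oppB hB lB]; split.
- move=> [[a1 b1] [a2 b2]] W [[U V] [/= Ua Vb] UV].
  have [[U1 U2] [/= U1a U2a] HU] := addA (a1, a2) U Ua.
  have [[V1 V2] [/= V1b V2b] HV] := addB (b1, b2) V Vb.
  exists (U1 `*` V1, U2 `*` V2); first by split; [exists (U1, V1)|exists (U2, V2)].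
  move=> [[x1 y1] [x2 y2]] [[/= x1U y1V] [/= x2U y2V]].
  apply: UV; split => /=; first exact: (HU (x1, x2) (conj x1U x2U)).
  exact: (HV (y1, y2) (conj y1V y2V)).
- move=> [a b] W [[U V] [/= Ua Vb] UV].
  exists (-%R @^-1` U, -%R @^-1` V); first by split; [exact: oppA|exact: oppB].
  by move=> [x y] [/= xU yV]; apply: UV.
- exact: hausdorff_prod.
- exact: locally_compact_prod.
Qed.

Lemma closure_subgroup (T : zmodTopType) (P : set T) :
  LCA_group T -> is_subgroup P -> is_subgroup (closure P).
Proof.
move=> [addT oppT _ _] gP; split; first by apply: subset_closure; exact: subgroup0.
move=> a b cla clb B Bab.
have [[U V] [/= Ua Vb] UV] := addT (a, - b) B Bab.
have [p [Pp Up]] := cla U Ua.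
have [q [Pq Vq]] := clb _ (oppT b V Vb).
exists (p - q); split; first exact: subgroupB.
exact: (UV (p, - q) (conj Up Vq)).
Qed.

Lemma closed_dense (T : topologicalType) (A : set T) : closed A -> dense A -> A = setT.
Proof.
move=> cA dA; apply/seteqP; split => // x _; apply: cA => B Bx.
have [y [By Ay]] := dA B° (ex_intro _ x Bx) (open_interior B).
by exists y; split => //; exact: interior_subset.
Qed.

Lemma dense_closure (T : topologicalType) (A : set T) : closure A = setT -> dense A.
Proof.
move=> clA O [x Ox] oO; have clx : closure A x by rewrite clA.
by rewrite setIC; apply: clx; exact: open_nbhs_nbhs.
Qed.

End TopologicalGroups.

Section Dotv.
Context {R : realType} {d : nat}.
Implicit Types x y z : 'rV[R]_d.

Lemma dotvDr x y z : dotv x (y + z) = dotv x y + dotv x z.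
Proof. by rewrite !dotvE linearD mulmxDr mxE. Qed.

Lemma dotvNr x y : dotv x (- y) = - dotv x y.
Proof. by rewrite !dotvE linearN mulmxN mxE. Qed.

Lemma dotvNl x y : dotv (- x) y = - dotv x y.
Proof. by rewrite dotvC dotvNr dotvC. Qed.

Lemma dotv_continuous x : continuous (dotv x).
Proof.
have -> : dotv x = (fun M : 'M[R]_(1, 1) => M 0 0) \o (fun y => y *m x^T).
  by apply/funext => y /=; rewrite dotvC dotvE.
move=> y; apply: (continuous_comp (@mulmxr_continuous R 1 _ _ x^T y)).
exact: (@coord_continuous R 1 1 0 0 _).
Qed.

End Dotv.

(** * Density in [H x K] from the absence of matching characters *)

Section DenseExtension.
Context {R : realType} {d : nat} {H : zmodTopType}.
Variable D : set 'rV[R]_d.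
Hypothesis latD : is_lattice D.
Let gD := lattice_subgroup latD.

Lemma expi_dual (y a b : 'rV[R]_d) : dual_lattice D y -> D (a - b) ->
  expi (dotv y a) = expi (dotv y b).
Proof.
move=> yD Dab; rewrite -[a](subrK b) dotvDr expiD [expi (dotv y (a - b))]expi_int.
  by rewrite /cmul /= !mul1r !mul0r subr0 addr0.
by rewrite dotvC; exact: yD.
Qed.

(** To be applied to the projection of the new lattice to [H x K]; the condition on [y] and [chi] is
    the form in which the annihilator enters. *)
Lemma dense_extension (S : set (H * torus D)) :
  LCA_group H -> is_subgroup S -> dense (fst @` S) ->
  (forall y chi, dual_lattice D y -> character chi ->
     (forall h x, S (h, quot_map D x) -> chi h = expi (dotv y x)) -> y = 0) ->
  dense S.
Proof.
move=> lcaH gS dS noChar; pose A := closure S.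
have gA : is_subgroup A.
  by apply: closure_subgroup => //; apply: LCA_prod => //; exact: torus_LCA.
have cA : closed A by exact: closed_closure.
(* The projection of [A] to [H] is closed, by compactness of the torus, and contains the dense
   projection of [S]. *)
have fibre h : exists k, A (h, k).
  have : (fst @` A) h.
    rewrite (@closed_dense _ (fst @` A))//.
      by apply: compact_projection_closed cA; exact: torus_compact.
    move=> O O0 oO; have [x [Ox [z Sz zx]]] := dS O O0 oO.
    by exists x; split => //; exists z => //; exact: subset_closure.
  by move=> [[h' k] /= Ahk <-]; exists k.
pose P := [set x : 'rV[R]_d | A (0, quot_map D x)].
have gP : is_subgroup P.
  split; first exact: (subgroup0 gA).
  move=> a b Pa Pb; rewrite /P /= quot_mapB -(subr0 0).
  exact: (subgroupB gA Pa Pb).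
have cP : closed P.
  have ct : continuous (fun x : 'rV[R]_d => (0 : H, quot_map D x)).
    by move=> x; exact: (cvg_pair (cvg_cst _) (@quot_map_continuous _ _ D x)).
  exact: ((continuous_closedP _).1 ct A cA).
have [PT|/existsNP[x0 nPx0]] := pselect (forall x, P x).
  apply: dense_closure; apply/seteqP; split => // -[h k] _.
  have [l Ahl] := fibre h.
  have -> : (h, k) = (h, l) + (0, quot_map D (repr (k - l))) :> H * torus D.
    by rewrite quot_mapK; congr pair => /=; [rewrite addr0|rewrite addrC subrK].
  exact: (subgroupD gA Ahl (PT _)).
have [y /eqP y0 yP] := closed_subgroup_annihilator gP cP nPx0.
have yD : dual_lattice D y.
  move=> x Dx; rewrite dotvC; apply: yP; rewrite /P /=.
  suff -> : quot_map D x = 0 by exact: (subgroup0 gA).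
  by rewrite -quot_map0; apply/quot_map_eq => //; rewrite subr0.
(* [E] is the character of the torus induced by [y]; the chosen representative is immaterial because
   [y] is in the dual lattice. *)
pose E : torus D -> R * R := (fun x => expi (dotv y x)) \o repr.
have cE : continuous E.
  apply: torus_map_continuous => // [x|a b Dab]; last exact: expi_dual.
  exact: (continuous_comp (@dotv_continuous _ _ y x) (@expi_continuous _ _)).
have EE x : E (quot_map D x) = expi (dotv y x).
  by apply: expi_dual => //; exact: torus_repr.
have ED k l : E (k + l) = cmul (E k) (E l).
  by rewrite -[k]quot_mapK -[l]quot_mapK -quot_mapD// !EE dotvDr expiD.
have [kk Akk] := choice fibre.
(* Two points of [A] over the same [h] differ by an element [(0, k)] of [A], on which [y] is
   integral. Hence [E] composed with the arbitrary selection [kk] is independent of that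
   selection. *)
have chiE h k : A (h, k) -> E (kk h) = E k.
  move=> Ahk; rewrite -[kk h](subrK k) ED.
  have -> : E (kk h - k) = (1, 0).
    apply/expi_int/yP; rewrite /P /= quot_mapK.
    have -> : (0, kk h - k) = (h, kk h) - (h, k) :> H * torus D.
      by congr pair; rewrite /= subrr.
    exact: (subgroupB gA (Akk h) Ahk).
  by rewrite /cmul /= !mul1r !mul0r subr0 addr0.
case: y0; apply: (noChar y (E \o kk)) => //.
  split.
  - (* Preimages of closed sets are projections along the compact torus. *)
    apply/continuous_closedP => C cC.
    have -> : (E \o kk) @^-1` C = fst @` (A `&` snd @^-1` (E @^-1` C)).
      apply/seteqP; split => [h Ch|h [[h' k] [/= Ahk Ck] <-]].
        by exists (h, kk h).
      by rewrite /= (chiE _ _ Ahk).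
    apply: compact_projection_closed; first exact: torus_compact.
    apply: closedI => //; apply: preimage_closed; first by move=> z _; exact: cvg_snd.
    exact: (continuous_closedP _).1 cE C cC.
  - by move=> h; exact: expi_norm.
  - move=> a b; rewrite /= -ED; apply: chiE.
    have -> : (a + b, kk a + kk b) = (a, kk a) + (b, kk b) :> H * torus D by [].
    exact: (subgroupD gA (Akk a) (Akk b)).
by move=> h x Shx; rewrite /= -EE; apply: chiE; exact: subset_closure.
Qed.

End DenseExtension.

(** * Transfer of the cut-and-project axioms to the extended lattice *)

Section CutAndProject.
Context {R : realType} {d : nat} {H : zmodTopType}.
Variables (L : set ('rV[R]_d * H)) (D : set 'rV[R]_d).

Definition extended_star (x : 'rV[R]_d) : H * torus D := (star L x, quot_map D x).

Definition extended_lattice : set ('rV[R]_d * (H * torus D)) :=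
  (fun x => (x, extended_star x)) @` (fst @` L).

Hypotheses (cpL : cut_and_project L) (latD : is_lattice D).
Let gD := lattice_subgroup latD.

Lemma starE x h : L (x, h) -> star L x = h.
Proof.
move=> Lxh; have [_ _ _ inj _] := cpL.
by rewrite /star; case: xgetP => [h' _ Lxh'|/(_ h)//]; have [] := inj _ _ Lxh' Lxh erefl.
Qed.

(** The new lattice is [L] with a torus coordinate forced by the first coordinate; its algebraic and
    topological properties are read off from those of [L] through this description. *)
Lemma extended_latticeP x h k :
  extended_lattice (x, (h, k)) <-> L (x, h) /\ k = quot_map D x.
Proof.
split=> [[_ [[a b] Lab <-] /= [<- <- <-]]|[Lxh ->]]; first by rewrite (starE Lab).
by exists x; [exists (x, h)|rewrite /extended_star (starE Lxh)].
Qed.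

Lemma extended_lattice_subgroup : is_subgroup extended_lattice.
Proof.
have [_ _ [gL _] _ _] := cpL; split.
  by apply/extended_latticeP; split => //; exact: (subgroup0 gL).
move=> [a [b k]] [a' [b' k']] /extended_latticeP[Lab ->] /extended_latticeP[Lab' ->].
apply/extended_latticeP; split; last by rewrite quot_mapB.
exact: (subgroupB gL Lab Lab').
Qed.

Lemma extended_lattice_discrete : discrete_subset extended_lattice.
Proof.
have [_ _ [_ [dL _]] _ _] := cpL.
move=> [a [b k]] /extended_latticeP[Lab kE].
have [U [[V W] [/= Va Wb] VW] LU] := dL _ Lab.
exists (V `*` (W `*` setT)).
  exists (V, W `*` setT) => //; split => //.
  by exists (W, setT) => //; split => //; exact: filterT.
move=> [a' [b' k']] [/extended_latticeP[Lab' k'E] [/= Va' [/= Wb' _]]].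
have [] : (a', b') = (a, b) by apply: LU; split => //; apply: VW.
by rewrite k'E kE => -> ->.
Qed.

Lemma extended_lattice_cocompact : cocompact extended_lattice.
Proof.
have [_ _ [_ [_ [C cC LC]]] _ _] := cpL.
pose f (z : ('rV[R]_d * H) * torus D) := (z.1.1, (z.1.2, z.2)).
(* The compact set may contain the whole torus, so any torus coordinate is corrected there; [f] only
   regroups the factors. *)
exists (f @` (C `*` setT)).
  apply: continuous_compact.
    by apply: continuous_subspaceT; exact: prodA_continuous.
  by apply: compact_setX => //; exact: torus_compact.
move=> [g [h k]]; have [[c1 c2] [[a b] [Cc Lab] [gE hE]]] := LC (g, h).
exists (c1, (c2, k - quot_map D a)), (a, (b, quot_map D a)).
  split; first by exists ((c1, c2), k - quot_map D a).
  exact/extended_latticeP.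
by rewrite gE hE; congr pair; congr pair; rewrite /= subrK.
Qed.

Lemma extended_lattice_dense :
  dual_lattice D `&` (fst @` annihilator L) = [set 0] ->
  dense (snd @` extended_lattice).
Proof.
move=> dualD; have [_ lcaH [gL _] _ dL] := cpL.
apply: dense_extension => //.
- have g' := extended_lattice_subgroup; split; first by exists 0 => //; exact: (subgroup0 g').
  by move=> _ _ [z Lz <-] [w Lw <-]; exists (z - w) => //; exact: (subgroupB g' Lz Lw).
- suff -> : fst @` (snd @` extended_lattice) = snd @` L by [].
  apply/seteqP; split=> [_ [_ [[a [b k]] /extended_latticeP[Lab _] <-] <-]|_ [[a b] Lab <-]].
    by exists (a, b).
  exists (b, quot_map D a) => //; exists (a, (b, quot_map D a)) => //.
  exact/extended_latticeP.
move=> y chi yD cchi chiE; apply/eqP; rewrite -oppr_eq0; apply/eqP.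
(* The sign is needed because [chi] equals [expi (dotv y a)] at the star of [a], while the
   annihilator requires the product of the two factors to be 1. *)
have : (dual_lattice D `&` (fst @` annihilator L)) (- y).
  split; first by move=> x Dx; rewrite dotvNr rpredN; exact: yD.
  exists (- y, chi) => //; split => // -[a b] Lab /=.
  rewrite (chiE b a); last by exists (a, (b, quot_map D a)) => //; exact/extended_latticeP.
  by rewrite -expiD dotvNl addNr expi_int// rpred0.
by rewrite dualD.
Qed.

Lemma cut_and_project_extended :
  dual_lattice D `&` (fst @` annihilator L) = [set 0] ->
  cut_and_project extended_lattice.
Proof.
move=> dualD; have [lcaG lcaH _ inj _] := cpL; split => //.
- by apply: LCA_prod => //; exact: torus_LCA.
- split; first exact: extended_lattice_subgroup.
  by split; [exact: extended_lattice_discrete|exact: extended_lattice_cocompact].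
- move=> [a [b k]] [a' [b' k']].
  move=> /extended_latticeP[Lab ->] /extended_latticeP[Lab' ->] /= aa'.
  by have [-> ->] := inj _ _ Lab Lab' aa'.
- exact: extended_lattice_dense.
Qed.

Lemma star_extended_lattice x :
  (fst @` extended_lattice) x -> star extended_lattice x = extended_star x.
Proof.
have uniq z : extended_lattice (x, z) -> z = extended_star x by move=> [w _ [-> <-]].
move=> [[x' z] L'z /= xE]; rewrite /star; case: xgetP => [w _ /uniq//|/(_ z)].
by rewrite /= -xE.
Qed.

Lemma extended_star_inj :
  D `&` (fst @` L) = [set 0] -> set_inj (fst @` L) extended_star.
Proof.
move=> DL x y; rewrite !inE => -[[x' b] Lxb /= xx'] [[y' c] Lyc /= yy'] [_].
rewrite -xx' -yy'.
move=> /(@quot_map_eq _ _ _ gD) Dxy; have [_ _ [gL _] _ _] := cpL.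
(* Equality of the torus coordinates alone decides: the difference lies in [D] and, [L] being a
   subgroup, in the projection of [L]. *)
have : (D `&` (fst @` L)) (x' - y').
  by split=> //; exists ((x', b) - (y', c)) => //; exact: (subgroupB gL Lxb Lyc).
by rewrite DL => /subr0_eq.
Qed.

Lemma model_set_extended (W : set H) :
  model_set L W = model_set extended_lattice (W `*` setT).
Proof.
apply/seteqP; split=> x [].
  move=> [a b] [Lab [_ /= Wb]] ax; exists (a, (b, quot_map D a)) => //.
  by split => //; exact/extended_latticeP.
move=> [a [b k]] [/extended_latticeP[Lab _] [_ [/= Wb _]]] ax.
by exists (a, b).
Qed.

End CutAndProject.

Theorem theorem6p5 (R : realType) (d : nat) (H : zmodTopType)
  (L : set ('rV[R]_d * H)) (D : set 'rV[R]_d) :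
  cut_and_project L ->
  countable L ->
  countable (annihilator L) ->
  is_lattice D ->
  D `&` (fst @` L) = [set 0] ->
  dual_lattice D `&` (fst @` annihilator L) = [set 0] ->
  let phi : 'rV[R]_d -> (H * torus D)%type := fun x => (star L x, quot_map D x) in
  let L' : set ('rV[R]_d * (H * torus D)) := (fun x => (x, phi x)) @` (fst @` L) in
  [/\ (cut_and_project L' /\
       (forall x, (fst @` L') x -> star L' x = phi x) /\
       set_inj (fst @` L) phi),
      (forall W : set H, model_set L W = model_set L' (W `*` setT)) &
      ((sigma_compact H -> sigma_compact (H * torus D)%type) /\
       (metrisable R H -> metrisable R (H * torus D)%type))].
Proof.
move=> cpL _ _ latD DL dualD; split.
- split; first exact: cut_and_project_extended.
  by split; [exact: star_extended_lattice|exact: extended_star_inj].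
- exact: model_set_extended.
- split=> [scH|mH]; first by apply: sigma_compact_prod => //; exact: torus_compact.
  by apply: metrisable_prod => //; exact: torus_metrisable.
Qed.
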